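(* Let $k\ge 1$ be an integer, let $\lambda_I,\lambda_E>0$ and $\mu_I,\mu_E>0$ with $\rho=\frac{\lambda_I}{k\mu_I}+\frac{\lambda_E}{k\mu_E}<1$, and suppose $\mu_I\ge\mu_E$. Then for every allocation policy $\pi$, $$\mathbb{E}[N^{\mathrm{IF}}]\le\mathbb{E}[N^{\pi}]\qquad\text{and}\qquad \mathbb{E}[T^{\mathrm{IF}}]\le\mathbb{E}[T^{\pi}],$$ where $\mathrm{IF}$ is the Inelastic-First policy.
   Context: Model. There are $k$ identical servers, each processing work at rate $1$. Inelastic jobs arrive according to a Poisson process of rate $\lambda_I$ and elastic jobs according to an independent Poisson process of rate $\lambda_E$. Job sizes (amounts of inherent work) are independent of each other and of the arrivals, $\mathrm{Exp}(\mu_I)$ for inelastic jobs and $\mathrm{Exp}(\mu_E)$ for elastic jobs, and are unknown to the scheduler. Jobs are preemptible, and fractional allocations are allowed. A job allocated $n\in\mathbb{R}_{\ge0}$ servers is processed at rate $n$. An inelastic job may be allocated at most $1$ server at any time; an elastic job may be allocated any number of servers; in total at most $k$ servers are allocated. A job leaves when its remaining size is $0$. State. $N_I^\pi(t)$ and $N_E^\pi(t)$ are the numbers of inelastic and elastic jobs in the system at time $t$ under policy $\pi$; state $(i,j)$ means $i$ inelastic and $j$ elastic jobs. Allocation policies. Policies are stationary and deterministic: in each state $(i,j)\in\mathbb{Z}_{\ge0}^2$ policy $\pi$ allocates a total of $\pi_I(i,j)\ge0$ servers to inelastic jobs and $\pi_E(i,j)\ge0$ servers to elastic jobs, with $\pi_I(i,j)\le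 i$, $\pi_E(i,j)\le k\mathbf{1}_{\{j>0\}}$, $\pi_I(i,j)+\pi_E(i,j)\le k$ (servers may be left idle). The division within each class does not depend on the unknown sizes. Thus $(N_I^\pi(t),N_E^\pi(t))$ is a continuous-time Markov chain with transitions from $(i,j)$ to $(i+1,j)$, $(i,j+1)$, $(i-1,j)$, $(i,j-1)$ at rates $\lambda_I$, $\lambda_E$, $\pi_I(i,j)\mu_I$, $\pi_E(i,j)\mu_E$ respectively. Inelastic-First ($\mathrm{IF}$): strict preemptive priority to inelastic jobs, first-come-first-served within each class. In state $(i,j)$ with $i<k$, each inelastic job gets one server and the remaining $k-i$ servers go to the elastic job with the earliest arrival time, if there is one; if $i\ge k$, the $k$ inelastic jobs with the earliest arrival times get one server each. Performance measures. $N^\pi=N_I^\pi+N_E^\pi$ is the total number of jobs in steady state. $T^\pi$ is the response time (time from arrival to completion) of a job arriving to the system in steady state under $\pi$; by Little's law $\mathbb{E}[T^\pi]=\mathbb{E}[N^\pi]/(\lambda_I+\lambda_E)$. If $\pi$ admits no stationary distribution, $\mathbb{E}[T^\pi]=\mathbb{E}[N^\pi]=+\infty$ by convention. *)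

(* Defs.v *)
From HB Require Import structures.
From mathcomp Require Import all_boot all_order all_algebra.
From mathcomp Require Import all_classical all_reals all_analysis.

Set Implicit Arguments.
Unset Strict Implicit.
Unset Printing Implicit Defensive.

Import Order.TTheory GRing.Theory Num.Theory.
Local Open Scope ring_scope.

(* A state (i, j) of type nat * nat stands for i inelastic and j elastic
   jobs.  Allocations are totals per class. *)
Record policy (R : realType) (k : nat) := Policy {
  alloc_I : nat -> nat -> R;
  alloc_E : nat -> nat -> R;
  alloc_I_ge0 : forall i j, 0 <= alloc_I i j;
  alloc_E_ge0 : forall i j, 0 <= alloc_E i j;
  alloc_I_le : forall i j, alloc_I i j <= i%:R;
  alloc_E_le : forall i j, alloc_E i j <= if (0 < j)%N then k%:R else 0;
  alloc_IE_le : forall i j, alloc_I i j + alloc_E i j <= k%:R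
}.

Section InelasticFirst.
Variables (R : realType) (k : nat).

Definition IF_I (i j : nat) : R := (minn i k)%:R.

(* The truncated subtraction k - i is 0 when i >= k. *)
Definition IF_E (i j : nat) : R := if (0 < j)%N then (k - i)%:R else 0.

Lemma IF_I_ge0 i j : 0 <= IF_I i j.
Proof. exact: ler0n. Qed.

Lemma IF_E_ge0 i j : 0 <= IF_E i j.
Proof. by rewrite /IF_E; case: ifP => // _; exact: ler0n. Qed.

Lemma IF_I_le i j : IF_I i j <= i%:R.
Proof. by rewrite ler_nat geq_minl. Qed.

Lemma IF_E_le i j : IF_E i j <= if (0 < j)%N then k%:R else 0.
Proof. by rewrite /IF_E; case: ifP => // _; rewrite ler_nat leq_subr. Qed.

Lemma IF_IE_le i j : IF_I i j + IF_E i j <= k%:R.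
Proof.
rewrite /IF_I /IF_E; case: ifP => _; last by rewrite addr0 ler_nat geq_minr.
by rewrite -natrD ler_nat minnC minnE subnK ?leq_subr.
Qed.

Definition inelastic_first : policy R k :=
  Policy IF_I_ge0 IF_E_ge0 IF_I_le IF_E_le IF_IE_le.

End InelasticFirst.

(* Transition rate of (N_I, N_E) from s to t.  Departures are tested as
   "s is t plus one job", so no truncated predecessor is involved. *)
Definition rate (R : realType) (k : nat) (lambdaI lambdaE muI muE : R)
    (pol : policy R k) (s t : nat * nat) : R :=
  if t == (s.1.+1, s.2) then lambdaI
  else if t == (s.1, s.2.+1) then lambdaE
  else if s == (t.1.+1, t.2) then alloc_I pol s.1 s.2 * muI
  else if s == (t.1, t.2.+1) then alloc_E pol s.1 s.2 * muE
  else 0.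

(* Stationary distribution of a continuous-time Markov chain on T with jump
   rates q: a probability mass function p with p Q = 0, Q the generator, that
   is, probability flux out of t = probability flux into t. *)
Definition stationary (R : realType) (T : choiceType) (q : T -> T -> R)
    (p : T -> R) : Prop :=
  [/\ forall t, 0 <= p t,
      \esum_(t in [set: T]) (p t)%:E = 1%E
    & forall t, \esum_(s in [set: T]) (p t * q t s)%:E
              = \esum_(s in [set: T]) (p s * q s t)%:E].

Section Performance.
Variables (R : realType) (k : nat) (lambdaI lambdaE muI muE : R).

(* The choice of p is immaterial when the arrival rates are positive: any two
   states lead, by arrivals only, to a common state, so there is at most one
   closed communicating class.  The total jump rate out of a state being
   bounded, the chain does not explode. *)
Definition mean_jobs (pol : policy R k) : \bar R :=
  if pselect (exists p, stationary (rate lambdaI lambdaE muI muE pol) p)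
    is left ex_p
  then \esum_(s in [set: nat * nat]) ((s.1 + s.2)%:R * projT1 (cid ex_p) s)%:E
  else +oo%E.

(* E[T] = E[N] / (arrival rate), by Little's law; the law of T itself also
   depends on the division within each class, which a policy leaves open. *)
Definition mean_response_time (pol : policy R k) : \bar R :=
  (mean_jobs pol * ((lambdaI + lambdaE)^-1)%:E)%E.

End Performance.

(* Main.v *)
(* Uniformize the chain: [step pol] is one jump of a discrete-time chain with
   the same stationary laws as [pol].  Let v_n = (step IF)^n njobs be the
   expected number of jobs after n jumps under Inelastic-First.  The inequalities
   "v increases in i and in j, and muI (v(i,j) - v(i-1,j)) >=
   muE (v(i,j) - v(i,j-1))" hold for njobs because muE <= muI, are preserved by
   [step IF], and make IF the minimizing one-step allocation.  If q is stationary
   for [pol], then E_q v_(n+1) = E_q (step IF v_n) <= E_q (step pol v_n) = E_q v_n,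
   so the IF chain started from q never has more than E_q njobs jobs on average.
   When this is finite, the Cesaro means of its laws are tight and have a limit
   point, which is stationary for IF and has mean at most E_q njobs; the
   stationary law of IF is unique. *)
Require Import Defs.
From HB Require Import structures.
From mathcomp Require Import all_boot all_order all_algebra.
From mathcomp Require Import all_classical all_reals all_analysis.
From mathcomp Require Import finmap zify lra ring.

Set Implicit Arguments.
Unset Strict Implicit.
Unset Printing Implicit Defensive.

Import Order.TTheory GRing.Theory Num.Theory.
Import numFieldNormedType.Exports.
Local Open Scope classical_set_scope.
Local Open Scope ring_scope.

(** * Sums over countable types and ultrafilter limits *)

Section Esum.
Context {R : realType} {T : choiceType}.
Implicit Types (a b : T -> R) (c : R).
Local Open Scope ereal_scope.

Lemma le_esum_seq a (F : seq T) : (forall t, 0 <= a t)%R -> uniq F ->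
  (\sum_(t <- F) a t)%:E <= \esum_(t in [set: T]) (a t)%:E.
Proof.
move=> a0 uF; apply: esum_ge; exists [set` F]; first by split.
by rewrite -sumEFin -fsbig_seq.
Qed.

Lemma esum_le_seq a (c : \bar R) :
  (forall F : seq T, uniq F -> (\sum_(t <- F) a t)%:E <= c) ->
  \esum_(t in [set: T]) (a t)%:E <= c.
Proof.
move=> h; apply: ge_ereal_sup => _ [X [finX _] <-].
by rewrite fsbig_finite//= sumEFin; exact/h/fset_uniq.
Qed.

Lemma esumZl (c : R) (a : T -> \bar R) : (0 <= c)%R ->
  (forall t, 0 <= a t) ->
  \esum_(t in [set: T]) (c%:E * a t) = c%:E * \esum_(t in [set: T]) a t.
Proof.
move=> c0 a0; rewrite /esum -ereal_supZl//; last first.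
  by apply/set0P; exists 0; exists set0; [exact: fsets_set0|rewrite fsbig_set0].
congr ereal_sup; apply/seteqP; split=> y /=.
  move=> [X XT <-]; exists (\sum_(x \in X) a x); first by exists X.
  by rewrite ge0_mule_fsumr.
move=> [_ [X XT <-] <-]; exists X => //.
by rewrite ge0_mule_fsumr.
Qed.

Lemma le_esum_term (a : T -> \bar R) t : (forall t, 0 <= a t) ->
  a t <= \esum_(t in [set: T]) a t.
Proof.
move=> a0; apply: esum_ge; exists [set t]; first by split.
by rewrite fsbig_set1.
Qed.

Lemma esum_single (a : T -> \bar R) t0 : 0 <= a t0 ->
  (forall t, t != t0 -> a t = 0) -> \esum_(t in [set: T]) a t = a t0.
Proof.
move=> a0 h; rewrite -[RHS]esum_set1// [RHS]esum_mkcond; apply: eq_esum => t _.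
case: ifPn => //; rewrite notin_setE/= => /eqP; exact: h.
Qed.

(** Finiteness lets the sum of [a] be cancelled, so the nonnegative differences [b t - a t] sum to
    at most 0. This turns comparisons of total mass into pointwise equalities. *)
Lemma esum_le_eq a b : (forall t, 0 <= a t)%R -> (forall t, a t <= b t)%R ->
  \esum_(t in [set: T]) (a t)%:E < +oo ->
  \esum_(t in [set: T]) (b t)%:E <= \esum_(t in [set: T]) (a t)%:E ->
  a =1 b.
Proof.
move=> a0 ab fin le t; apply/eqP; rewrite eq_le ab/= -subr_le0.
have d0 u : 0 <= (b u - a u)%:E by rewrite lee_fin subr_ge0.
have /le_trans : (b t - a t)%:E <= \esum_(u in [set: T]) (b u - a u)%:E.
  exact: (@le_esum_term (fun u => (b u - a u)%:E)).
rewrite -lee_fin; apply.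
have finA : \esum_(u in [set: T]) (a u)%:E \is a fin_num.
  by rewrite ge0_fin_numE//; apply: esum_ge0 => u _; rewrite lee_fin.
have e : \esum_(u in [set: T]) (b u)%:E =
    \esum_(u in [set: T]) (b u - a u)%:E + \esum_(u in [set: T]) (a u)%:E.
  rewrite -esumD//; last by move=> u _; rewrite lee_fin.
  by apply: eq_esum => u _; rewrite -EFinD subrK.
by move: le; rewrite e -[leRHS]add0e leeD2rE.
Qed.

End Esum.

Lemma esum_exchange {R : realType} {S T : choiceType} (a : S -> T -> \bar R) :
  (forall s t, 0 <= a s t)%E ->
  (\esum_(s in [set: S]) \esum_(t in [set: T]) a s t =
   \esum_(t in [set: T]) \esum_(s in [set: S]) a s t)%E.
Proof.
move=> a0; rewrite !esum_esum//=.
apply: (@reindex_esum _ _ _ _ _ (fun z : T * S => (z.2, z.1))) => //.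
split => //=; first by move=> [x y] [z w] _ _ /= [-> ->].
by move=> [s t] _; exists (t, s).
Qed.

(** Only maximality needs an argument: if [A] lies in a proper filter [H] containing [u @ G], then
    its preimage is in [G], since otherwise the complement of [A] would be in [H] too. *)
Lemma ultra_fmap (S T : Type) (u : S -> T) (G : set_system S) :
  UltraFilter G -> UltraFilter (u @ G).
Proof.
move=> UG; split; first exact: fmap_proper_filter.
move=> H PH sub; apply/seteqP; split=> // A HA.
have [//|GA] := in_ultra_setVsetC (u @^-1` A) UG.
have /filter_ex[x []] : H (A `&` ~` A) by apply: filterI => //; exact: sub.
by [].
Qed.

(** A single ultrafilter serves all bounded sequences, so every coordinate gets a limit without
    extracting subsequences. *)
Lemma ultra_bounded_cvg {R : realType} (G : set_system nat) (u : nat -> R) :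
  UltraFilter G -> (forall n, 0 <= u n <= 1) -> exists l : R, (u @ G --> l).
Proof.
move=> UG u01; have := @segment_compact R 0 1.
rewrite compact_ultra => /(_ (u @ G) (ultra_fmap u UG)) [].
  by apply: (@filterE _ G) => n /=; rewrite in_itv/=.
by move=> l [_ ?]; exists l.
Qed.

(** * Invariant distributions of Markov kernels *)

Section MarkovKernel.
Context {R : realType} {T : choiceType}.
Variable K : T -> T -> R.
Hypothesis K_ge0 : forall s t, 0 <= K s t.
Hypothesis K_sum1 : forall s, (\esum_(t in [set: T]) (K s t)%:E = 1)%E.
Implicit Types (p v w : T -> R).

(** It has three readings: the expectation of [v] under [p]; for [v := K^~ t], the mass at [t] of
    [p] moved by [K]; for [p := K s], the value at [s] of [K] applied to [v]. *)
Definition mean p v : \bar R := (\esum_(t in [set: T]) (p t * v t)%:E)%E.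

Definition distribution p : Prop :=
  (forall t, 0 <= p t) /\ (\esum_(t in [set: T]) (p t)%:E = 1)%E.

Definition invariant p : Prop := forall t, mean p (K^~ t) = (p t)%:E.

Lemma kernel_le1 s t : K s t <= 1.
Proof.
rewrite -lee_fin -(K_sum1 s).
by apply: (@le_esum_term _ _ (fun u => (K s u)%:E)) => u; rewrite lee_fin.
Qed.

Lemma mean_ge0 p v : (forall t, 0 <= p t) -> (forall t, 0 <= v t) ->
  (0 <= mean p v)%E.
Proof. by move=> p0 v0; apply: esum_ge0 => t _; rewrite lee_fin mulr_ge0. Qed.

(** Tonelli's theorem in the form (pK)v = p(Kv). *)
Lemma esum_mean_kernel p v w :
  (forall t, 0 <= p t) -> (forall t, 0 <= v t) ->
  (forall s, mean (K s) v = (w s)%:E) ->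
  (\esum_(t in [set: T]) mean p (K^~ t) * (v t)%:E = mean p w)%E.
Proof.
move=> p0 v0 Kv.
transitivity (\esum_(t in [set: T]) \esum_(s in [set: T])
    (p s * (K s t * v t))%:E)%E.
  apply: eq_esum => t _; rewrite muleC -esumZl//; last first.
    by move=> s; rewrite lee_fin mulr_ge0.
  by apply: eq_esum => s _; rewrite -EFinM; congr EFin; ring.
rewrite esum_exchange; last by move=> s t; rewrite lee_fin !mulr_ge0.
apply: eq_esum => s _.
rewrite EFinM -Kv /mean -esumZl//; last by move=> t; rewrite lee_fin mulr_ge0.
Qed.

Lemma esum_mass_kernel p : (forall t, 0 <= p t) ->
  (\esum_(t in [set: T]) mean p (K^~ t) = \esum_(t in [set: T]) (p t)%:E)%E.
Proof.
move=> p0.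
have K1 s : mean (K s) (fun=> 1) = 1%:E.
  by rewrite -(K_sum1 s); apply: eq_esum => t _; rewrite mulr1.
transitivity (mean p (fun=> 1)); last by apply: eq_esum => t _; rewrite mulr1.
by rewrite -(esum_mean_kernel p0 _ K1)//; apply: eq_esum => t _; rewrite mule1.
Qed.

Lemma mean_kernel_fin p t : (forall t, 0 <= p t) ->
  (\esum_(s in [set: T]) (p s)%:E < +oo)%E -> mean p (K^~ t) \is a fin_num.
Proof.
move=> p0 fin; rewrite ge0_fin_numE ?mean_ge0//.
apply: le_lt_trans fin; apply: le_esum => s _.
by rewrite lee_fin ler_piMr// kernel_le1.
Qed.

(** [K] preserves total mass, so an inequality between two families of the same finite mass is an
    equality at each point. *)
Lemma subinvariant_invariant p : (forall t, 0 <= p t) ->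
  (\esum_(t in [set: T]) (p t)%:E < +oo)%E ->
  (forall t, mean p (K^~ t) <= (p t)%:E)%E -> invariant p.
Proof.
move=> p0 fin sub.
have fineK t : ((fine (mean p (K^~ t)))%:E = mean p (K^~ t))%E.
  by rewrite fineK// mean_kernel_fin.
suff e : (fun t => fine (mean p (K^~ t))) =1 p by move=> t; rewrite -fineK e.
have eq_mass : (\esum_(t in [set: T]) (fine (mean p (K^~ t)))%:E =
    \esum_(t in [set: T]) (p t)%:E)%E.
  by rewrite -esum_mass_kernel//; apply: eq_esum => t _; rewrite fineK.
apply: esum_le_eq; rewrite ?eq_mass//.
- by move=> t; rewrite fine_ge0// mean_ge0.
- by move=> t; rewrite -lee_fin fineK.
Qed.

(* The pointwise minimum m of p and p' is subinvariant, hence invariant.  Mass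
   of p - m then spreads along K, and so does mass of p' - m; if both were
   nonzero they would have a common point, where m < min (p, p'). *)
Lemma invariant_unique p p' :
  (forall A B : set T,
     (forall s t, A s -> 0 < K s t -> A t) ->
     (forall s t, B s -> 0 < K s t -> B t) ->
     A !=set0 -> B !=set0 -> A `&` B !=set0) ->
  distribution p -> invariant p -> distribution p' -> invariant p' -> p =1 p'.
Proof.
move=> irr [p0 p1] pK [p'0 p'1] p'K.
pose m t := Num.min (p t) (p' t).
have mp t : m t <= p t by rewrite /m ge_min lexx.
have mp' t : m t <= p' t by rewrite /m ge_min lexx orbT.
have m0 t : 0 <= m t by rewrite /m le_min p0 p'0.
have fin1 (r : T -> R) : (\esum_(t in [set: T]) (r t)%:E = 1)%E ->
  (\esum_(t in [set: T]) (r t)%:E < +oo)%E by move=> ->; rewrite ltry.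
have mfin : (\esum_(t in [set: T]) (m t)%:E < +oo)%E.
  apply: le_lt_trans (fin1 _ p1).
  by apply: le_esum => t _; rewrite lee_fin.
have meanm r : (forall t, m t <= r t) -> invariant r ->
    forall t, (mean m (K^~ t) <= (r t)%:E)%E.
  move=> mr rK t; rewrite -rK; apply: le_esum => s _.
  by rewrite lee_fin ler_wpM2r.
have mK : invariant m.
  apply: subinvariant_invariant => // t.
  have := meanm p mp pK t; have := meanm p' mp' p'K t.
  rewrite -(fineK (mean_kernel_fin _ m0 mfin)) !lee_fin => h1 h2.
  by rewrite /m le_min h1 h2.
have spread r : (forall t, 0 <= r t) -> (forall t, m t <= r t) -> invariant r ->
    forall s t, m s < r s -> 0 < K s t -> m t < r t.
  (* If [m] and [r] agreed at [t], invariance would give equal sums of [m s * K s t] and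
     [r s * K s t]. As [m <= r], these agree term by term, and [0 < K s t] forces equality at
     [s]. *)
  move=> r0 mr rK s t ms Kst; rewrite lt_neqAle mr andbT; apply/eqP => mrt.
  have := @esum_le_eq _ _ (fun s => m s * K s t) (fun s => r s * K s t).
  move=> /(_ _ _ _ _ s)/= h; suff : m s * K s t = r s * K s t.
    by move/(mulIf (lt0r_neq0 Kst)) => e; rewrite e ltxx in ms.
  apply: h; first by move=> u; rewrite mulr_ge0.
  - by move=> u; rewrite ler_wpM2r.
  - by have := mK t; rewrite /mean => ->; rewrite ltry.
  - by have := mK t; have := rK t; rewrite /mean mrt => -> ->.
have minimal (r r' : T -> R) : (\esum_(t in [set: T]) (r t)%:E = 1)%E ->
    (\esum_(t in [set: T]) (r' t)%:E = 1)%E -> (forall t, 0 <= r t) ->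
    (forall t, r t <= r' t) -> r =1 r'.
  by move=> r1 r'1 r0 rr'; apply: (@esum_le_eq _ _ r r') => //; rewrite r1 ?r'1 ?ltry.
have [[s ms]|np] := pselect ([set t | m t < p t] !=set0); last first.
  apply: minimal => // t; apply: le_trans (mp' t); rewrite leNgt.
  by apply/negP => h; apply: np; exists t.
have [[s' ms']|np'] := pselect ([set t | m t < p' t] !=set0); last first.
  move=> t; apply/esym; move: t; apply: minimal => // t; apply: le_trans (mp t).
  by rewrite leNgt; apply/negP => h; apply: np'; exists t.
have [||||t [/= ht ht']] := irr [set t | m t < p t] [set t | m t < p' t].
- exact: spread.
- exact: spread.
- by exists s.
- by exists s'.
- have : m t < m t by rewrite {2}/m lt_min ht ht'.
  by rewrite ltxx.
Qed.

(** * Iterated laws, Cesaro means and existence of an invariant distribution *)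

Definition push p (t : T) : R := fine (mean p (K^~ t)).

Lemma pushE p t : distribution p -> (push p t)%:E = mean p (K^~ t).
Proof. by move=> [p0 p1]; rewrite fineK// mean_kernel_fin// p1 ltry. Qed.

Lemma distribution_push p : distribution p -> distribution (push p).
Proof.
move=> dp; have [p0 p1] := dp; split.
  by move=> t; rewrite fine_ge0// mean_ge0.
rewrite -p1 -[RHS]esum_mass_kernel//.
by apply: eq_esum => t _; exact: pushE.
Qed.

Lemma distribution_iter_push p n : distribution p ->
  distribution (iter n push p).
Proof. by move=> dp; elim: n => //= n; exact: distribution_push. Qed.

Lemma mean_push p v w : distribution p -> (forall t, 0 <= v t) ->
  (forall s, mean (K s) v = (w s)%:E) -> mean (push p) v = mean p w.
Proof.
move=> dp v0 Kv; have [p0 p1] := dp; rewrite -(esum_mean_kernel p0 v0 Kv).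
by apply: eq_esum => t _; rewrite EFinM pushE.
Qed.

Lemma distribution_le1 p t : distribution p -> p t <= 1.
Proof.
move=> [p0 p1]; rewrite -lee_fin -p1.
by apply: (@le_esum_term _ _ (fun t => (p t)%:E)) => u; rewrite lee_fin.
Qed.

(** Markov's inequality: off [F], [p t] is at most [p t * v t / M], so the mass outside [F] is at
    most [C / M]. *)
Lemma markov_tail p v (C M : R) (F : seq T) : uniq F -> 0 < M ->
  (forall t, 0 <= v t) -> (forall t, t \notin F -> M <= v t) ->
  distribution p -> (mean p v <= C%:E)%E -> 1 - C / M <= \sum_(t <- F) p t.
Proof.
move=> uF M0 v0 vM [p0 p1] pv.
rewrite lerBlDr -lee_fin -p1.
have -> : (\sum_(t <- F) p t + C / M)%:E =
    (\esum_(t in [set: T]) (if t \in F then p t else 0)%:E + (M^-1)%:E * C%:E)%E.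
  rewrite EFinD [C / M]mulrC EFinM; congr (_ + _)%E.
  rewrite -sumEFin fsbig_seq// -esum_fset//; last first.
    by move=> t _; rewrite lee_fin.
  rewrite esum_mkcond; apply: eq_esum => t _.
  by rewrite mem_setE; case: ifP.
apply: (@le_trans _ _ (\esum_(t in [set: T]) (if t \in F then p t else 0)%:E +
    (M^-1)%:E * mean p v)%E); last first.
  by rewrite leeD2l// lee_wpmul2l// lee_fin invr_ge0 ltW.
have Mi : 0 <= M^-1 by rewrite invr_ge0 ltW.
rewrite -esumZl//; last by move=> t; rewrite lee_fin mulr_ge0.
rewrite -esumD; last 2 first.
- by move=> t _; rewrite lee_fin; case: ifP.
- by move=> t _; rewrite -EFinM lee_fin !mulr_ge0.
apply: le_esum => t _; rewrite -EFinM -EFinD lee_fin.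
case: ifPn => [_|/vM Mv]; first by rewrite lerDl !mulr_ge0.
by rewrite add0r mulrCA ler_peMr// mulrC ler_pdivlMr// mul1r.
Qed.

Definition cesaro q (n : nat) (t : T) : R :=
  n.+1%:R^-1 * \sum_(m < n.+1) iter m push q t.

Lemma mean_cesaro q v n : distribution q -> (forall t, 0 <= v t) ->
  mean (cesaro q n) v =
  ((n.+1%:R^-1)%:E * \sum_(m < n.+1) mean (iter m push q) v)%E.
Proof.
move=> dq v0; have dqm m := distribution_iter_push m dq.
have qm0 m t : 0 <= iter m push q t by have [] := dqm m.
rewrite /mean -esum_sum; last by move=> t m _ _; rewrite lee_fin mulr_ge0.
rewrite -esumZl//; last first.
  by move=> t; apply: sume_ge0 => m _; rewrite lee_fin mulr_ge0.
apply: eq_esum => t _.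
by rewrite sumEFin -EFinM /cesaro -mulrA -mulr_suml.
Qed.

Lemma distribution_cesaro q n : distribution q -> distribution (cesaro q n).
Proof.
move=> dq; have dqm m := distribution_iter_push m dq.
split=> [t|].
  by rewrite mulr_ge0// sumr_ge0// => m _; have [] := dqm m.
transitivity (mean (cesaro q n) (fun=> 1)).
  by apply: eq_esum => t _; rewrite mulr1.
rewrite mean_cesaro// (eq_bigr (fun=> 1%:E)); last first.
  by move=> m _; have [_ <-] := dqm m; apply: eq_esum => t _; rewrite mulr1.
by rewrite sumEFin -EFinM sumr_const card_ord mulVf.
Qed.

(** Moving the average by [K] shifts time by one: the term [q t] is replaced by the law at time
    [n.+1], whose value is at most 1. The one-sided error vanishes in the limit. *)
Lemma cesaro_kernel q n t : distribution q ->
  (mean (cesaro q n) (K^~ t) <= (cesaro q n t + n.+1%:R^-1)%:E)%E.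
Proof.
move=> dq; have dqm m := distribution_iter_push m dq.
rewrite mean_cesaro// (eq_bigr (fun m : 'I_n.+1 => (iter m.+1 push q t)%:E)).
  rewrite sumEFin -EFinM lee_fin /cesaro -[X in _ <= _ + X]mulr1 -mulrDr.
  rewrite ler_wpM2l//.
  rewrite big_ord_recr/= [in leRHS]big_ord_recl/= addrAC.
  rewrite [leRHS](_ : _ = \sum_(i < n) push (iter i push q) t + (q t + 1)).
    rewrite lerD2l (le_trans (distribution_le1 t (dqm n.+1)))// lerDr.
    by have [] := dq.
  by rewrite addrC.
by move=> m _; rewrite -pushE.
Qed.

(* Tightness (bounded mean of v, finite sublevel sets) keeps the mass from
   escaping when the Cesaro means are taken to a limit along an ultrafilter;
   Fatou's lemma makes that limit subinvariant. *)
Lemma invariant_exists q v (C : R) : distribution q ->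
  (forall t, 0 <= v t) ->
  (forall M : R, exists2 F : seq T, uniq F & forall t, t \notin F -> M <= v t) ->
  (forall n, mean (iter n push q) v <= C%:E)%E ->
  exists p, [/\ distribution p, invariant p & (mean p v <= C%:E)%E].
Proof.
move=> dq v0 tight qv.
have dc n := distribution_cesaro n dq.
have c0 n t : 0 <= cesaro q n t by have [] := dc n.
have cv n : (mean (cesaro q n) v <= C%:E)%E.
  rewrite mean_cesaro//.
  apply: (@le_trans _ _ ((n.+1%:R^-1)%:E * \sum_(m < n.+1) C%:E)%E).
    by rewrite lee_wpmul2l// lee_sum.
  rewrite sumEFin -EFinM sumr_const card_ord -[C *+ _]mulr_natl mulKf//.
(* [G] is finer than [\oo], so limits along [\oo] persist along [G]. *)
have [G [UG ooG]] := @ultraFilterLemma nat \oo _.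
have [p cp] : {p : T -> R & forall t, cesaro q n t @[n --> G] --> p t}.
  apply: (@choice _ _ (fun t (l : R) => cesaro q n t @[n --> G] --> l)) => t.
  apply: ultra_bounded_cvg => n.
  by rewrite c0 (distribution_le1 t (dc n)).
have csum (F : seq T) (w : T -> R) :
    \sum_(t <- F) cesaro q n t * w t @[n --> G] --> \sum_(t <- F) p t * w t.
  elim: F => [|t F IH].
    by rewrite big_nil; under eq_fun do rewrite big_nil; exact: cvg_cst.
  rewrite big_cons; under eq_fun do rewrite big_cons.
  by apply: cvgD => //; apply: cvgMl.
have csum1 (F : seq T) :
    \sum_(t <- F) cesaro q n t @[n --> G] --> \sum_(t <- F) p t.
  have := csum F (fun=> 1).
  by under eq_fun do under eq_bigr do rewrite mulr1;
    under eq_bigr do rewrite mulr1.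
have inv0 : n.+1%:R^-1 @[n --> G] --> (0 : R).
  exact: cvg_trans (cvg_app _ ooG) cvg_harmonic.
have p0 t : 0 <= p t.
  by apply: (cvgr_to_ge (cp t)); apply: nearW => n; exact: c0.
have bound (F : seq T) (w : T -> R) (D : R) : (forall t, 0 <= w t) -> uniq F ->
    (forall n, mean (cesaro q n) w <= D%:E)%E -> \sum_(t <- F) p t * w t <= D.
  move=> w0 uF wD; apply: (cvgr_to_le (csum F w)); apply: nearW => n.
  rewrite -lee_fin; apply: le_trans (wD n).
  by apply: le_esum_seq => // t; rewrite mulr_ge0.
have p_le1 : (\esum_(t in [set: T]) (p t)%:E <= 1)%E.
  apply: esum_le_seq => F uF; rewrite lee_fin.
  rewrite [leLHS](_ : _ = \sum_(t <- F) p t * 1); last first.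
    by apply: eq_bigr => t _; rewrite mulr1.
  apply: bound => // n; have [_ <-] := dc n.
  by apply: le_esum => t _; rewrite mulr1.
have dp : distribution p.
  split=> //; apply/eqP; rewrite eq_le p_le1/=.
  apply/lee_addgt0Pr => e e0; rewrite -leeBlDr// -EFinB.
  (* Taking [M = C / e] in [markov_tail] leaves mass at least [1 - e] in [F]. This [M] must be
     positive, so [C <= 0] is treated apart with [M = 1]. *)
  have [C0|C0] := leP C 0.
    have [F uF Fv] := tight 1.
    apply: le_trans (le_esum_seq p0 uF); rewrite lee_fin.
    apply: (cvgr_to_ge (csum1 F)); apply: nearW => n.
    apply: le_trans (markov_tail uF ltr01 v0 Fv (dc n) (cv n)).
    by rewrite divr1 lerD2l lerN2 (le_trans C0)// ltW.
  have [F uF Fv] := tight (C / e).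
  apply: le_trans (le_esum_seq p0 uF); rewrite lee_fin.
  apply: (cvgr_to_ge (csum1 F)); apply: nearW => n.
  have Ce : 0 < C / e by rewrite divr_gt0.
  apply: le_trans (markov_tail uF Ce v0 Fv (dc n) (cv n)).
  by rewrite invf_div mulrCA divff ?mulr1// lt0r_neq0.
exists p; split=> //; last first.
  by apply: esum_le_seq => F uF; rewrite lee_fin; exact: bound.
have [_ p1] := dp.
apply: subinvariant_invariant => //; first by rewrite p1 ltry.
move=> t; apply: esum_le_seq => F uF; rewrite lee_fin.
rewrite -[p t]addr0; apply: (ler_cvg_to (csum F (K^~ t)) (cvgD (cp t) inv0)).
apply: nearW => n; rewrite -lee_fin; apply: le_trans (cesaro_kernel n t dq).
by apply: le_esum_seq => // s; rewrite mulr_ge0.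
Qed.

End MarkovKernel.

(** * The uniformized two-class chain *)

Section Chain.
Context {R : realType} (k : nat) (lambdaI lambdaE muI muE : R).
Hypotheses (lambdaI_gt0 : 0 < lambdaI) (lambdaE_gt0 : 0 < lambdaE).
Hypotheses (muI_gt0 : 0 < muI) (muE_gt0 : 0 < muE).
Implicit Types (pol : policy R k) (v : nat * nat -> R) (s t : nat * nat).

Local Notation rate := (rate lambdaI lambdaE muI muE).
Local Notation aI pol s := (alloc_I pol s.1 s.2).
Local Notation aE pol s := (alloc_E pol s.1 s.2).

Lemma alloc_I0 pol j : alloc_I pol 0 j = 0.
Proof. by apply/eqP; rewrite eq_le alloc_I_ge0 (le_trans (alloc_I_le _ _ _)). Qed.

Lemma alloc_E0 pol i : alloc_E pol i 0 = 0.
Proof. by apply/eqP; rewrite eq_le alloc_E_ge0 (le_trans (alloc_E_le _ _ _)). Qed.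

(* The truncated predecessors are harmless: an absent class is allocated 0. *)
Lemma rateE pol s t : rate pol s t =
  lambdaI * (t == (s.1.+1, s.2))%:R + lambdaE * (t == (s.1, s.2.+1))%:R +
  aI pol s * muI * (t == (s.1.-1, s.2))%:R +
  aE pol s * muE * (t == (s.1, s.2.-1))%:R.
Proof.
case: s t => [i j] [x y]; rewrite /Defs.rate /= !xpair_eqE.
have [->|i0] := posnP i; have [->|j0] := posnP j;
  rewrite ?alloc_I0 ?alloc_E0 ?(gtn_eqF (ltn0Sn _)) /=;
  (do ![case: (_ =P _) => ? /=]; try lia; ring).
Qed.

(** At [fun=> 1] this is the total jump rate out of [s]; subtracting that rate times [v s] gives the
    generator applied to [v]. *)
Definition flow pol v s : R :=
  lambdaI * v (s.1.+1, s.2) + lambdaE * v (s.1, s.2.+1) +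
  aI pol s * muI * v (s.1.-1, s.2) + aE pol s * muE * v (s.1, s.2.-1).

Lemma esum_pred1 (u : nat * nat) (c : R) v :
  0 <= c -> (forall t, 0 <= v t) ->
  (\esum_(t in [set: nat * nat]) (c * (t == u)%:R * v t)%:E = (c * v u)%:E)%E.
Proof.
move=> c0 v0; rewrite (esum_single (t0 := u)).
- by rewrite eqxx mulr1.
- by rewrite lee_fin !mulr_ge0.
- by move=> t /negPf ->; rewrite mulr0 mul0r.
Qed.

Lemma rate_ge0 pol s t : 0 <= rate pol s t.
Proof.
by rewrite rateE !addr_ge0// !mulr_ge0// ?alloc_I_ge0 ?alloc_E_ge0// ltW.
Qed.

Lemma mean_rate pol v s : (forall t, 0 <= v t) ->
  mean (rate pol s) v = (flow pol v s)%:E.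
Proof.
move=> v0; rewrite /mean /flow !EFinD.
have aI0 : 0 <= aI pol s * muI by rewrite mulr_ge0 ?alloc_I_ge0// ltW.
have aE0 : 0 <= aE pol s * muE by rewrite mulr_ge0 ?alloc_E_ge0// ltW.
have lI0 := ltW lambdaI_gt0; have lE0 := ltW lambdaE_gt0.
have pos c t u : 0 <= c -> (0 <= (c * (t == u)%:R * v t)%:E)%E.
  by move=> c0; rewrite lee_fin !mulr_ge0.
rewrite -!esum_pred1// -!esumD; try (by move=> t _; rewrite ?adde_ge0 ?pos).
by apply: eq_esum => t _; rewrite -!EFinD rateE -!mulrDl.
Qed.

(** One uniformization constant for all states and policies, so that steps of different policies are
    comparable. Counting both [k%:R * muI] and [k%:R * muE] leaves room for nonnegative self-loop
    coefficients in the increments of [step]. *)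
Let Lam := lambdaI + lambdaE + k%:R * muI + k%:R * muE.

Lemma Lam_gt0 : 0 < Lam.
Proof. by rewrite /Lam -addrA ltr_wpDr ?addr_gt0// addr_ge0// mulr_ge0// ltW. Qed.

Definition kernel pol s t : R :=
  Lam^-1 * (rate pol s t + (Lam - flow pol (fun=> 1) s) * (t == s)%:R).

Definition step pol v s : R :=
  Lam^-1 * (flow pol v s + (Lam - flow pol (fun=> 1) s) * v s).

Lemma flow_le_Lam pol s : flow pol (fun=> 1) s <= Lam.
Proof.
rewrite /flow !mulr1 /Lam.
have aIk : aI pol s <= k%:R.
  by apply: le_trans (alloc_IE_le pol s.1 s.2); rewrite lerDl alloc_E_ge0.
have aEk : aE pol s <= k%:R.
  by apply: le_trans (alloc_IE_le pol s.1 s.2); rewrite lerDr alloc_I_ge0.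
by rewrite !lerD// ler_wpM2r// ltW.
Qed.

Lemma kernel_ge0 pol s t : 0 <= kernel pol s t.
Proof.
rewrite mulr_ge0 ?invr_ge0 ?(ltW Lam_gt0)// addr_ge0 ?rate_ge0// mulr_ge0//.
by rewrite subr_ge0 flow_le_Lam.
Qed.

Lemma mean_kernel pol v s : (forall t, 0 <= v t) ->
  mean (kernel pol s) v = (step pol v s)%:E.
Proof.
move=> v0; rewrite /step EFinM EFinD -mean_rate//.
have L0 : 0 <= Lam - flow pol (fun=> 1) s by rewrite subr_ge0 flow_le_Lam.
have Li : 0 <= Lam^-1 by rewrite invr_ge0 (ltW Lam_gt0).
have rv t : 0 <= rate pol s t * v t by rewrite mulr_ge0 ?rate_ge0.
rewrite -esum_pred1// -esumD; last 2 first.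
- by move=> t _; rewrite lee_fin.
- by move=> t _; rewrite lee_fin !mulr_ge0.
rewrite -esumZl//; last by move=> t; rewrite -EFinD lee_fin addr_ge0// !mulr_ge0.
by apply: eq_esum => t _; rewrite -EFinD -EFinM -mulrDl mulrA.
Qed.

Lemma kernel_sum1 pol s :
  (\esum_(t in [set: nat * nat]) (kernel pol s t)%:E = 1)%E.
Proof.
transitivity (mean (kernel pol s) (fun=> 1)).
  by apply: eq_esum => t _; rewrite mulr1.
rewrite mean_kernel// /step mulr1 addrC subrK mulVf//.
exact: lt0r_neq0 Lam_gt0.
Qed.

(** The self-loop returns to [t] the part of [p t] that does not jump; cancelling it and scaling by
    [Lam] turns invariance into flux balance. *)
Lemma stationaryP pol p :
  stationary (rate pol) p <-> distribution p /\ invariant (kernel pol) p.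
Proof.
have out t : (forall t, 0 <= p t) ->
    (\esum_(s in [set: nat * nat]) (p t * rate pol t s)%:E =
     (p t * flow pol (fun=> 1) t)%:E)%E.
  move=> p0; rewrite EFinM -mean_rate// /mean -esumZl//; last first.
    by move=> s; rewrite lee_fin mulr1 rate_ge0.
  by apply: eq_esum => s _; rewrite mulr1.
have inn t : (forall t, 0 <= p t) -> mean p ((kernel pol)^~ t) =
    ((Lam^-1)%:E * (\esum_(s in [set: nat * nat]) (p s * rate pol s t)%:E +
                    (p t * (Lam - flow pol (fun=> 1) t))%:E))%E.
  move=> p0.
  have L0 s : 0 <= Lam - flow pol (fun=> 1) s by rewrite subr_ge0 flow_le_Lam.
  have pr s : 0 <= p s * rate pol s t by rewrite mulr_ge0 ?rate_ge0.
  have Li : 0 <= Lam^-1 by rewrite invr_ge0 (ltW Lam_gt0).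
  rewrite [p t * _](_ : _ = 1 * (p t * (Lam - flow pol (fun=> 1) t)));
    last by rewrite mul1r.
  rewrite -(@esum_pred1 t 1 (fun s => p s * (Lam - flow pol (fun=> 1) s)))//;
    last by move=> s; rewrite mulr_ge0.
  rewrite -esumD; last 2 first.
  - by move=> s _; rewrite lee_fin.
  - by move=> s _; rewrite lee_fin !mulr_ge0.
  rewrite -esumZl//; last first.
    by move=> s; rewrite -EFinD lee_fin addr_ge0// !mulr_ge0.
  apply: eq_esum => s _; rewrite -EFinD -EFinM /kernel [t == s]eq_sym.
  by congr EFin; ring.
have LN0 := lt0r_neq0 Lam_gt0.
split=> [[p0 p1 bal]|[[p0 p1] inv]]; split=> //.
  move=> t; rewrite inn// -bal out// -EFinD -EFinM; congr EFin.
  by rewrite -mulrDr addrC subrK mulrCA mulVf// mulr1.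
move=> t; rewrite out//; have := inv t; rewrite inn//.
set In := (\esum_(s in [set: nat * nat]) (p s * rate pol s t)%:E)%E.
have : (0 <= In)%E.
  by apply: esum_ge0 => s _; rewrite lee_fin mulr_ge0 ?rate_ge0.
case: In => [r _| _ |]//=.
- rewrite -EFinD -EFinM => -[h]; congr EFin.
  have := congr1 (fun x => Lam * x) h; rewrite mulVKf// => e; lra.
(* An infinite inflow contradicts invariance, whose right-hand side is real. *)
- by rewrite addye// mulry gtr0_sg ?invr_gt0 ?Lam_gt0// mul1e.
Qed.

(** Arrivals are possible in every state, so closed sets through [(i, j)] and [(i', j')] share the
    state with the coordinatewise sums. *)
Lemma stationary_unique pol p p' :
  stationary (rate pol) p -> stationary (rate pol) p' -> p =1 p'.
Proof.
move=> /stationaryP[dp ip] /stationaryP[dp' ip'].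
apply: (invariant_unique (kernel_ge0 pol) (kernel_sum1 pol)) dp ip dp' ip'.
have Kpos s t : 0 < rate pol s t -> 0 < kernel pol s t.
  move=> r; rewrite mulr_gt0 ?invr_gt0 ?Lam_gt0// ltr_wpDr// mulr_ge0//.
  by rewrite subr_ge0 flow_le_Lam.
have up (A : set (nat * nat)) :
    (forall s t, A s -> 0 < kernel pol s t -> A t) ->
    forall i j m n, A (i, j) -> A (i + m, j + n)%N.
  move=> cA i j m n Aij.
  have Am : A (i + m, j)%N.
    elim: m => [|m IH]; first by rewrite addn0.
    apply: cA IH _; apply: Kpos; rewrite /Defs.rate addnS eqxx.
    exact: lambdaI_gt0.
  elim: n => [|n IH]; first by rewrite addn0.
  apply: cA IH _; apply: Kpos; rewrite /Defs.rate addnS eqxx.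
  by rewrite xpair_eqE /= ltn_eqF//= lambdaE_gt0.
move=> A B cA cB [[i j] Aij] [[i' j'] Bij].
exists (i + i', j + j')%N; split; first exact: up.
by rewrite addnC [X in (_, X)]addnC; exact: up.
Qed.

(** * Optimality of Inelastic-First *)

Local Notation IF := (inelastic_first R k).

(** Monotonicity in [i] is imposed at [j = 0] only; elsewhere it follows from the other two
    conditions. The third compares the drops of [v] per server spent on each class. *)
Definition priority_cone v : Prop :=
  [/\ forall i j, v (i, j) <= v (i, j.+1),
      forall i, v (i, 0%N) <= v (i.+1, 0%N)
    & forall i j, muE * (v (i.+1, j.+1) - v (i.+1, j)) <=
                  muI * (v (i.+1, j.+1) - v (i, j.+1))].

(** [flow] is affine in the allocation. With both classes present, the gap is the gain from shifting
    servers from elastic to inelastic jobs until these have their [IF] share, plus the gain from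
    putting idle servers on elastic jobs; the cone makes both nonnegative. *)
Lemma step_IF_le pol v s : priority_cone v -> step IF v s <= step pol v s.
Proof.
case: s => i j [vE vI vIE].
rewrite /step ler_wpM2l ?invr_ge0 ?(ltW Lam_gt0)// /flow /= /IF_I /IF_E.
have := alloc_I_ge0 pol i j; have := alloc_E_ge0 pol i j.
have := alloc_I_le pol i j; have := alloc_E_le pol i j.
have := alloc_IE_le pol i j.
move: (alloc_I pol i j) (alloc_E pol i j) => a b.
rewrite -subr_ge0.
case: i => [|i]; case: j => [|j] /=.
- rewrite min0n => *; have -> : a = 0 by lra.
  have -> : b = 0 by lra.
  by lra.
- rewrite min0n subn0 => ab bk a0 b0 a0'; have -> : a = 0 by lra.
  rewrite [leRHS](_ : _ = (k%:R - b) * muE * (v (0, j.+1)%N - v (0, j)%N)).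
    by rewrite !mulr_ge0 ?subr_ge0// ltW.
  by ring.
- move=> ab b0 ai b0' a0; have -> : b = 0 by lra.
  have am : a <= (minn i.+1 k)%:R by rewrite natr_min le_min ai; lra.
  rewrite [leRHS](_ : _ =
    ((minn i.+1 k)%:R - a) * muI * (v (i.+1, 0)%N - v (i, 0)%N)); last by ring.
  by rewrite !mulr_ge0 ?subr_ge0// ltW.
- move=> ab bk ai b0 a0.
  have am : a <= (minn i.+1 k)%:R by rewrite natr_min le_min ai; lra.
  (* Despite the truncated subtraction, the two [IF] allocations add up to [k] here. *)
  have e : (k - i.+1)%:R = k%:R - (minn i.+1 k)%:R :> R.
    by rewrite -natrB ?geq_minr//; congr (_%:R); lia.
  rewrite e; move: (minn i.+1 k)%:R am e => m am _.
  rewrite [leRHS](_ : _ =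
    (m - a) * (muI * (v (i.+1, j.+1) - v (i, j.+1)) -
               muE * (v (i.+1, j.+1) - v (i.+1, j))) +
    (k%:R - (a + b)) * muE * (v (i.+1, j.+1) - v (i.+1, j))); last by ring.
  by rewrite addr_ge0// !mulr_ge0 ?subr_ge0// ltW.
Qed.

Lemma scaled_priority_cone (c : R) v : 0 <= c -> priority_cone v ->
  priority_cone (fun s => c * v s).
Proof.
move=> c0 [vE vI vIE]; split=> [i j|i|i j]; first by rewrite ler_wpM2l.
- by rewrite ler_wpM2l.
- by rewrite -!mulrBr ![_ * (c * _)]mulrCA ler_wpM2l.
Qed.

(* Each increment of [step IF v] controlled by the cone is a combination, with
   nonnegative coefficients, of such increments of v.  In the mixed one, with
   i < k, the terms [muI * muE * (v (i, j.+1) - v (i, j))] cancel. *)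
Lemma step_priority_cone v : priority_cone v -> priority_cone (step IF v).
Proof.
move=> [vE vI vIE].
apply: scaled_priority_cone; first by rewrite invr_ge0 ltW// Lam_gt0.
have lI0 := ltW lambdaI_gt0; have lE0 := ltW lambdaE_gt0.
have mI0 := ltW muI_gt0; have mE0 := ltW muE_gt0.
have vI' i j : v (i, j) <= v (i.+1, j).
  case: j => // j; rewrite -subr_ge0 -(pmulr_rge0 _ muI_gt0).
  by apply: le_trans (vIE i j); rewrite mulr_ge0// subr_ge0.
pose y i j := v (i, j.+1) - v (i, j); pose x i j := v (i.+1, j) - v (i, j).
have y0 i j : 0 <= y i j by rewrite subr_ge0.
have x0 i j : 0 <= x i j by rewrite subr_ge0.
pose z i j := muI * x i j.+1 - muE * y i.+1 j.
have z0 i j : 0 <= z i j by rewrite /z subr_ge0; exact: vIE.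
(* The self-loop rate common to two neighbouring states once their jumps are paired. *)
have krest (a b : R) : a <= k%:R -> b <= k%:R ->
    0 <= k%:R * muI + k%:R * muE - a * muI - b * muE.
  by move=> ak bk; rewrite -addrA addrACA -!mulrBl addr_ge0// mulr_ge0// subr_ge0.
have mk i : (minn i k)%:R <= k%:R :> R by rewrite ler_nat geq_minr.
have bk i : (k - i)%:R <= k%:R :> R by rewrite ler_nat leq_subr.
split=> [i j|i|i j]; rewrite -subr_ge0.
(* For [j = 0] an elastic departure takes the larger state to the smaller one, so it contributes
   nothing. *)
- rewrite [leRHS](_ : _ = lambdaI * y i.+1 j + lambdaE * y i j.+1 +
      (minn i k)%:R * muI * y i.-1 j +
      (if j is j'.+1 then (k - i)%:R * muE * y i j' else 0) +
      (k%:R * muI + k%:R * muE - (minn i k)%:R * muI - (k - i)%:R * muE) * y i j).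
    rewrite !addr_ge0 ?mulr_ge0 ?krest//.
    by case: (j) => // j'; rewrite !mulr_ge0.
  by rewrite /flow /= /IF_I /IF_E /y /Lam; case: j => [|j] /=; ring.
(* For [i < k] the extra inelastic job has its own server and its departure merges the two states;
   for [k <= i] both states allocate alike. The term [0 * muE] is there to match [krest]. *)
- have [ik|ki] := ltnP i k.
    rewrite [leRHS](_ : _ = lambdaI * x i.+1 0%N + lambdaE * x i 1%N +
      i%:R * muI * x i.-1 0%N +
      (k%:R * muI + k%:R * muE - i.+1%:R * muI - 0 * muE) * x i 0%N).
      by rewrite !addr_ge0 ?mulr_ge0 ?krest// ler_nat.
    rewrite /flow /= /IF_I /IF_E /x /Lam (minn_idPl ik) (minn_idPl (ltnW ik)) /=.
    by case: i {ik} => [|i] /=; ring.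
  rewrite [leRHS](_ : _ = lambdaI * x i.+1 0%N + lambdaE * x i 1%N +
      k%:R * muI * x i.-1 0%N +
      (k%:R * muI + k%:R * muE - k%:R * muI - 0 * muE) * x i 0%N).
    by rewrite !addr_ge0 ?mulr_ge0 ?krest.
  rewrite /flow /= /IF_I /IF_E /x /Lam (minn_idPr ki) (minn_idPr (leqW ki)) /=.
  (* For [i = 0], [k <= i] forces [k = 0], which removes the term in the truncated predecessor
     [i.-1]. *)
  case: i ki => [|i] ki /=; last by ring.
  by move: ki; rewrite leqn0 => /eqP ->; ring.
- have [ik|ki] := ltnP i k.
    (* The extra 1 is the server that [(i, j.+1)] gives to elastic work and [(i.+1, j.+1)] to its
       additional inelastic job. *)
    have e : (k - i)%:R = (k - i.+1)%:R + 1 :> R.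
      by rewrite -[1]/(1%:R) -natrD; congr (_%:R); lia.
    have e' : (k - i.+1)%:R = k%:R - i.+1%:R :> R by rewrite natrB.
    (* For [j = 0] the elastic departure from [(i.+1, 1)] merges with [(i.+1, 0)], so [z] loses its
       negative part and [muI * x i 0] remains. *)
    rewrite [leRHS](_ : _ = lambdaI * z i.+1 j + lambdaE * z i j.+1 +
      i%:R * muI * z i.-1 j +
      (k - i.+1)%:R * muE *
        (if j is j'.+1 then z i j' else muI * x i 0%N) +
      (k%:R * muI + k%:R * muE - i.+1%:R * muI - (k - i.+1)%:R * muE) * z i j).
      rewrite !addr_ge0// ?mulr_ge0 ?krest// ?ler_nat//.
      by case: (j) => [|j'] //; exact: mulr_ge0.
    rewrite /flow /= /IF_I /IF_E /z /x /y /Lam (minn_idPl ik).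
    rewrite (minn_idPl (ltnW ik)) e /=.
    by case: j => [|j]; case: i {ik e e'} => [|i] /=; ring.
  rewrite [leRHS](_ : _ = lambdaI * z i.+1 j + lambdaE * z i j.+1 +
      k%:R * muI * z i.-1 j +
      (k%:R * muI + k%:R * muE - k%:R * muI - 0 * muE) * z i j).
    by rewrite !addr_ge0 ?mulr_ge0 ?krest.
  rewrite /flow /= /IF_I /IF_E /z /x /y /Lam (minn_idPr ki) (minn_idPr (leqW ki)).
  have /eqP -> : (k - i == 0)%N by rewrite subn_eq0.
  have /eqP -> : (k - i.+1 == 0)%N by rewrite subn_eq0 leqW.
  case: i ki => [|i] ki /=; last by case: j => [|j] /=; ring.
  by move: ki; rewrite leqn0 => /eqP ->; case: j => [|j] /=; ring.
Qed.

(** * Comparison of the stationary means *)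

Definition njobs s : R := (s.1 + s.2)%:R.

Lemma step_ge0 pol v : (forall s, 0 <= v s) -> forall s, 0 <= step pol v s.
Proof.
by move=> v0 s; rewrite -lee_fin -mean_kernel// mean_ge0//; exact: kernel_ge0.
Qed.

Lemma mean_iter_push pol q v n : distribution q -> (forall s, 0 <= v s) ->
  mean (iter n (push (kernel pol)) q) v = mean q (iter n (step pol) v).
Proof.
move=> dq; elim: n v => // n IH v v0; rewrite [in RHS]iterSr -IH; last exact: step_ge0.
rewrite iterS; apply: (mean_push (kernel_ge0 pol) (kernel_sum1 pol)) => //.
- exact: (distribution_iter_push (kernel_ge0 pol) (kernel_sum1 pol)).
- by move=> s; exact: mean_kernel.
Qed.

Lemma finite_njobs_sublevel (M : R) :
  exists2 F : seq (nat * nat), uniq F & forall s, s \notin F -> M <= njobs s.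
Proof.
have [N MN] : exists N : nat, M <= N%:R.
  by exists (Num.bound `|M|); apply: le_trans (ler_norm _) (ltW (archi_boundP _)).
(* This square contains every state with fewer than [N] jobs. *)
exists [seq (i, j) | i <- iota 0 N, j <- iota 0 N].
  by apply: allpairs_uniq; rewrite ?iota_uniq// => -[? ?] [? ?].
move=> [i j] nF; apply: le_trans MN _; rewrite ler_nat /=.
rewrite leqNgt; apply/negP => ijN; move/negP: nF; apply.
by apply/allpairsP; exists (i, j); split; rewrite // mem_iota/=; lia.
Qed.

Hypothesis muE_le_muI : muE <= muI.

Lemma njobs_priority_cone : priority_cone njobs.
Proof.
split=> [i j|i|i j]; rewrite /njobs/= ?ler_nat; try lia.
rewrite !addnS !addSn.
by rewrite -!natrB ?leqnSn// !subSnn !mulr1.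
Qed.

Lemma mean_iter_step_IF_le pol q n : stationary (rate pol) q ->
  (mean q (iter n (step IF) njobs) <= mean q njobs)%E.
Proof.
move=> /stationaryP[dq iq]; have [q0 _] := dq.
(* Cone membership is carried along for [step_IF_le], nonnegativity for [mean_push]. *)
suff [] : [/\ priority_cone (iter n (step IF) njobs),
    forall s, 0 <= iter n (step IF) njobs s
  & (mean q (iter n (step IF) njobs) <= mean q njobs)%E] by [].
elim: n => [|n [cn n0 le_n]]; first by split=> //; exact: njobs_priority_cone.
split; rewrite iterS; [exact: step_priority_cone|exact: step_ge0|].
apply: le_trans le_n; set v := iter n _ _ in cn n0 *.
have pushq : push (kernel pol) q = q by apply/funext => t; rewrite /push iq.
have -> : mean q v = mean q (step pol v).
  rewrite -{1}pushq; apply: (mean_push (kernel_ge0 pol) (kernel_sum1 pol)) => //.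
  by move=> s; exact: mean_kernel.
by apply: le_esum => s _; rewrite lee_fin ler_wpM2l// step_IF_le.
Qed.

(** By uniqueness, the law chosen by [cid] is [p]. *)
Lemma mean_jobsE pol p : stationary (rate pol) p ->
  mean_jobs lambdaI lambdaE muI muE pol = mean p njobs.
Proof.
move=> sp; rewrite /mean_jobs; case: pselect => [ex_p|]; last first.
  by move=> np; exfalso; apply: np; exists p.
have /funext -> := stationary_unique (projT2 (cid ex_p)) sp.
by apply: eq_esum => s _; rewrite mulrC.
Qed.

Lemma mean_jobs_IF_le pol :
  (mean_jobs lambdaI lambdaE muI muE IF
     <= mean_jobs lambdaI lambdaE muI muE pol)%E.
Proof.
have [[q sq]|nq] := pselect (exists q, stationary (rate pol) q); last first.
  by rewrite [leRHS]/mean_jobs; case: pselect => // _; rewrite leey.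
rewrite (mean_jobsE sq); have [dq _] := (stationaryP pol q).1 sq.
have njobs0 s : 0 <= njobs s by rewrite /njobs.
have q0 : (0 <= mean q njobs)%E by apply: mean_ge0 => //; case: dq.
have : forall n, (mean (iter n (push (kernel IF)) q) njobs <= mean q njobs)%E.
  by move=> n; rewrite mean_iter_push// (mean_iter_step_IF_le _ sq).
(* An infinite mean leaves nothing to prove. A finite one, [C], bounds the means of all iterates
   under [IF], and this bound produces the stationary law of [IF]. *)
case: (mean q njobs) q0 => [C _ le_C| _ _|//]; last by rewrite leey.
have [p [dp ip pC]] := invariant_exists (kernel_ge0 IF) (kernel_sum1 IF) dq
  njobs0 finite_njobs_sublevel le_C.
by rewrite (mean_jobsE (p := p))//; apply/stationaryP.
Qed.

End Chain.

Theorem theorem5 (R : realType) (k : nat) (lambdaI lambdaE muI muE : R)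
    (k_ge1 : (1 <= k)%N)
    (lambdaI_gt0 : 0 < lambdaI) (lambdaE_gt0 : 0 < lambdaE)
    (muI_gt0 : 0 < muI) (muE_gt0 : 0 < muE)
    (rho_lt1 : lambdaI / (k%:R * muI) + lambdaE / (k%:R * muE) < 1)
    (muE_le_muI : muE <= muI)
    (pol : policy R k) :
  (mean_jobs lambdaI lambdaE muI muE (inelastic_first R k)
     <= mean_jobs lambdaI lambdaE muI muE pol)%E /\
  (mean_response_time lambdaI lambdaE muI muE (inelastic_first R k)
     <= mean_response_time lambdaI lambdaE muI muE pol)%E.
Proof.
have le_jobs : (mean_jobs lambdaI lambdaE muI muE (inelastic_first R k)
    <= mean_jobs lambdaI lambdaE muI muE pol)%E by exact: mean_jobs_IF_le.
split=> //; rewrite /mean_response_time lee_wpmul2r// lee_fin invr_ge0.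
by rewrite addr_ge0// ltW.
Qed.
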